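(* Let $S = R\cup B$ be a finite set of points in the plane in general position (no three collinear), colored red ($R$) and blue ($B$), with $R$ and $B$ linearly separable. Then $S$ has a balanced convex $4$-hole if and only if condition C1 or condition C2 holds.
   Context: A $4$-hole of $S$ is a simple quadrilateral with vertices in $S$ and no point of $S$ in its interior; it is convex if the quadrilateral is convex, and balanced if it has exactly two red and two blue vertices. $CH(X)$ is the convex hull of $X$; $\Delta xyz$ is the open triangle with vertices $x,y,z$; for non-collinear $a,b,c$, $\mathcal{W}(a,b,c)$ is the open convex region bounded by the rays from $a$ through $b$ and from $a$ through $c$. An edge $e$ of $CH(R)$ and an edge $e'$ of $CH(B)$ see each other if the union of their vertex sets is the vertex set of a balanced convex $4$-hole whose interior intersects neither $CH(R)$ nor $CH(B)$. Condition C1: there exist an edge $e$ of $CH(R)$ and an edge $e'$ of $CH(B)$ that see each other. Condition C2: there exist an edge $\overline{uv}$ of $CH(R)$ and points $b,z\in B$ with $z\in\Delta uvb$, $R\cap\Delta uvb=\emptyset$ and $R\cap\mathcal{W}(b,u,v)\ne\emptyset$; or the same statement holds with the roles of $R$ and $B$ swapped. *)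

(* Defs.v *)
From HB Require Import structures.
From mathcomp Require Import all_boot all_order all_algebra.
Set Implicit Arguments. Unset Strict Implicit. Unset Printing Implicit Defensive.
Import Order.TTheory GRing.Theory Num.Theory.
Local Open Scope ring_scope.

Section Geom.
Variable F : realFieldType.
Notation pt := (F * F)%type.

(* twice the signed area of triangle pqr; > 0 iff p,q,r is a left turn *)
Definition orient (p q r : pt) : F :=
  (q.1 - p.1) * (r.2 - p.2) - (q.2 - p.2) * (r.1 - p.1).

Definition general_position (S : seq pt) : Prop :=
  forall p q r, p \in S -> q \in S -> r \in S ->
    p != q -> q != r -> p != r -> orient p q r != 0.

Definition lin_separable (Rs Bs : seq pt) : Prop :=
  exists a b c : F,
    (forall p, p \in Rs -> 0 < a * p.1 + b * p.2 + c) /\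
    (forall p, p \in Bs -> a * p.1 + b * p.2 + c < 0).

Definition in_hull (X : seq pt) (x : pt) : Prop :=
  exists w : nat -> F,
    (forall i, 0 <= w i) /\ \sum_(i < size X) w i = 1 /\
    x.1 = \sum_(i < size X) w i * (nth (0, 0) X i).1 /\
    x.2 = \sum_(i < size X) w i * (nth (0, 0) X i).2.

Definition hull_edge (X : seq pt) (u v : pt) : Prop :=
  [/\ u \in X, v \in X, u != v &
      (forall p, p \in X -> 0 <= orient u v p) \/
      (forall p, p \in X -> orient u v p <= 0)].

(* p1 p2 p3 p4 (in this cyclic order) is a convex quadrilateral,
   oriented counterclockwise: every consecutive triple is a strict left turn *)
Definition convex_quad (p1 p2 p3 p4 : pt) : Prop :=
  [/\ 0 < orient p1 p2 p3, 0 < orient p2 p3 p4,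
      0 < orient p3 p4 p1 & 0 < orient p4 p1 p2].

Definition in_quad_interior (p1 p2 p3 p4 x : pt) : Prop :=
  [/\ 0 < orient p1 p2 x, 0 < orient p2 p3 x,
      0 < orient p3 p4 x & 0 < orient p4 p1 x].

Definition balanced_convex_4hole (Rs Bs : seq pt) (p1 p2 p3 p4 : pt) : Prop :=
  [/\ all (fun p => p \in Rs ++ Bs) [:: p1; p2; p3; p4],
      convex_quad p1 p2 p3 p4,
      count (fun p => p \in Rs) [:: p1; p2; p3; p4] = 2%N,
      count (fun p => p \in Bs) [:: p1; p2; p3; p4] = 2%N &
      forall q, q \in Rs ++ Bs -> ~ in_quad_interior p1 p2 p3 p4 q].

Definition has_balanced_convex_4hole (Rs Bs : seq pt) : Prop :=
  exists p1 p2 p3 p4, balanced_convex_4hole Rs Bs p1 p2 p3 p4.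

Definition see_each_other (Rs Bs : seq pt) (u v u' v' : pt) : Prop :=
  exists p1 p2 p3 p4,
    [/\ balanced_convex_4hole Rs Bs p1 p2 p3 p4,
        [:: u; v; u'; v'] =i [:: p1; p2; p3; p4] &
        forall x, in_quad_interior p1 p2 p3 p4 x ->
          ~ in_hull Rs x /\ ~ in_hull Bs x].

Definition condC1 (Rs Bs : seq pt) : Prop :=
  exists u v u' v',
    [/\ hull_edge Rs u v, hull_edge Bs u' v' & see_each_other Rs Bs u v u' v'].

Definition open_tri (a b c x : pt) : Prop :=
  exists s t r : F, [/\ 0 < s, 0 < t, 0 < r & s + t + r = 1] /\
    x.1 = s * a.1 + t * b.1 + r * c.1 /\ x.2 = s * a.2 + t * b.2 + r * c.2.

Definition wedge (a b c x : pt) : Prop :=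
  exists s t : F, [/\ 0 < s, 0 < t,
    x.1 = a.1 + s * (b.1 - a.1) + t * (c.1 - a.1) &
    x.2 = a.2 + s * (b.2 - a.2) + t * (c.2 - a.2)].

Definition condC2_half (X Y : seq pt) : Prop :=
  exists u v b z,
    [/\ hull_edge X u v, b \in Y, z \in Y & open_tri u v b z] /\
    (forall r, r \in X -> ~ open_tri u v b r) /\
    (exists r, r \in X /\ wedge b u v r).

Definition condC2 (Rs Bs : seq pt) : Prop :=
  condC2_half Rs Bs \/ condC2_half Bs Rs.

End Geom.

(* Main.v *)
Require Import Defs.
From HB Require Import structures.
From mathcomp Require Import all_boot all_order all_algebra ring lra.
Import Order.TTheory GRing.Theory Num.Theory.
Local Open Scope ring_scope.

Set Implicit Arguments.
Unset Strict Implicit.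

(** (=>) Let p q b a be a balanced convex 4-hole, with p, q red and a, b blue.
Since no red point lies in it, a single edge uv of CH(R) crosses it from side pa
to side qb; likewise a single edge cd of CH(B). The points of R, resp. B, lie
beyond uv, resp. cd, so these two edges see each other unless the line of one of
them separates the endpoints of the other, say d is on the red side of uv. Then u
is in the triangle cdv, which gives C2 if a is in W(v,c,d); otherwise c is in the
triangle uva, and p or q is in W(a,u,v), which is C2 again.

(<=) Given C2, with uv, b and a red point r in W(b,u,v), let z' and z be the first
and second blue points of the triangle uvb by direction from u. If there is no z,
then b, z', a red point beyond uv and one of u, v form a hole. If z' is in the
triangle uvz, then z' is the only blue point of that triangle and the same
argument applies to z in place of b. Otherwise u v z' z is a hole. *)

(** * Sign calculus for an edge that crosses a convex quadrilateral *)

Section SignedOrientation.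
Variables (F : realFieldType) (e : F).
Local Notation pt := (F * F)%type.

Definition aff (k : F * F * F) (x : pt) : F :=
  k.1.1 * x.1 + k.1.2 * x.2 + k.2.

(* The scale [e] is instantiated with [1] and [-1]: reversing the orientation and
   exchanging left and right gives every lemma together with its mirror image. *)
Definition sor (p q r : pt) : F := e * orient p q r.
Local Notation o := sor.

Ltac o_ring := rewrite /aff /sor /orient; ring.

Definition squad p q b a : bool :=
  [&& 0 < o p q b, 0 < o q b a, 0 < o b a p & 0 < o a p q].

(* [u -> v] crosses the convex quadrilateral [p q b a], entering through the side
   [pa] and leaving through [qb], with [p], [q] on its right and [a], [b] on its left. *)
Definition traverses p q b a u v : bool :=
  [&& o u v p <= 0, o u v q <= 0, 0 < o u v a, 0 < o u v b,
      o a p u <= 0, 0 < o a p v, o q b v <= 0 & 0 < o q b u].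

(** Two lines confine [r]: it cannot lie beyond [pq], since it is left of [uv] while [p] and [q] are
    not, nor beyond [ba], since [k] is positive at [r] and negative at [a] and [b]. *)
Lemma traverses_gap k p q b a u v r :
  squad p q b a -> traverses p q b a u v ->
  aff k a < 0 -> aff k b < 0 -> 0 < aff k q -> 0 < aff k r ->
  0 < o u v r -> 0 <= o a p r -> 0 <= o q b r -> 0 < o p q r /\ 0 < o b a r.
Proof.
move=> /and4P[c1 c2 c3 c4] /and5P[tp tq ta tb _] ka kb kq kr uvr apr qbr.
have pqr : 0 < o p q r.
  rewrite ltNge; apply/negP => pqr.
  (* Barycentric expansion of the affine map [o u v] over the triangle [a p q]. The second half
     repeats this with [aff k] over [q b a]. *)
  have E1 : o u v r * o a p q =
    o u v p * o q a r + o u v q * o a p r + o u v a * o p q r by o_ring.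
  have E2 : o p q r * o q b a = - o q a r * o p q b + o q b r * o a p q by o_ring.
  have qar : o q a r < 0 by clear -E1 uvr c4 tp tq ta apr pqr; nra.
  clear -E2 pqr c2 qar c1 qbr c4; nra.
split=> //; rewrite ltNge; apply/negP => bar.
have E1 : aff k r * o q b a = aff k q * o b a r + aff k b * o a q r + aff k a * o q b r
  by o_ring.
have E2 : o b a r * o a p q = - o a q r * o b a p + o a p r * o q b a by o_ring.
have aqr : o a q r < 0 by clear -E1 kr c2 kq bar kb ka qbr; nra.
clear -E2 bar c4 aqr c3 apr c2; nra.
Qed.

(** Replacing [u] by [r] turns the edge about [v]. The new edge meets the line [pa] strictly closer
    to [a], but where [k] is still positive, hence before [a]; likewise on [qb], weakly. The two
    products compare the positions of the crossing points without division. *)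
Lemma traverses_step k p q b a u v r :
  squad p q b a -> traverses p q b a u v ->
  aff k a < 0 -> aff k b < 0 -> 0 < aff k u -> 0 < aff k v -> 0 < aff k r ->
  0 < o u v r -> o a p r < 0 ->
  [/\ traverses p q b a r v,
      o u v a * o r v p < o u v p * o r v a &
      o u v b * o r v q <= o u v q * o r v b].
Proof.
move=> /and4P[c1 c2 c3 c4] /and5P[tp tq ta tb /and4P[apu apv qbv qbu]].
move=> ka kb ku kv kr uvr apr.
have E1 : o u v a * o r v p - o u v p * o r v a = - o a p v * o u v r by o_ring.
have E2 : o u v b * o r v q - o u v q * o r v b = o q b v * o u v r by o_ring.
have Ek1 : o u v a * aff k p - o u v p * aff k a = o a p v * aff k u - o a p u * aff k v
  by o_ring.
have Ek2 : o u v b * aff k q - o u v q * aff k b = o q b u * aff k v - o q b v * aff k u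
  by o_ring.
have rva : 0 < o r v a.
  rewrite ltNge; apply/negP => rva.
  have E : aff k a * (o a p v * o u v r) =
     (o a p v * aff k u - o a p u * aff k v) * - o r v a
     + aff k v * (o u v a * - o a p r) + aff k r * (o u v a * o a p v) by o_ring.
  have h1 : 0 < o a p v * aff k u - o a p u * aff k v by clear -apv apu ku kv; nra.
  have h2 : 0 < o u v a * o a p v by exact: mulr_gt0.
  have h3 : 0 < o u v a * - o a p r by apply: mulr_gt0; rewrite ?oppr_gt0.
  have h4 : 0 < o a p v * o u v r by exact: mulr_gt0.
  clear -h1 h2 h3 h4 E rva ka kv kr; nra.
have rvp : o r v p < 0.
  have h : 0 < o a p v * o u v r by exact: mulr_gt0.
  clear -h E1 rva ta tp; nra.
have qbr : 0 < o q b r.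
  rewrite ltNge; apply/negP => qbr.
  have E : o r v a * o q b p - o r v p * o q b a = o a p v * o q b r - o a p r * o q b v
    by o_ring.
  have qbp : 0 < o q b p by have -> : o q b p = o p q b by o_ring.
  clear -E rva qbp rvp c2 apv qbr apr qbv; nra.
have rvb : 0 < o r v b.
  rewrite ltNge; apply/negP => rvb.
  have E : aff k b * (- o q b v * o u v r) =
     (o q b u * aff k v - o q b v * aff k u) * - o r v b
     + aff k v * (o u v b * o q b r) + aff k r * (o u v b * - o q b v) by o_ring.
  have h1 : 0 < o q b u * aff k v - o q b v * aff k u by clear -qbu qbv ku kv; nra.
  have h2 : 0 < o u v b * o q b r by exact: mulr_gt0.
  have h3 : 0 <= o u v b * - o q b v by apply: mulr_ge0; rewrite ?oppr_ge0 // ltW.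
  have h4 : 0 <= - o q b v * o u v r by apply: mulr_ge0; rewrite ?oppr_ge0 // ltW.
  clear -h1 h2 h3 h4 E rvb kb kv kr; nra.
have h1 : 0 < o a p v * o u v r by exact: mulr_gt0.
have h2 : o q b v * o u v r <= 0 by clear -qbv uvr; nra.
split; last by clear -E2 h2; lra.
  have rvq : o r v q <= 0 by clear -E2 h2 tb tq rvb; nra.
  by rewrite /traverses (ltW rvp) rvq rva rvb (ltW apr) apv qbv qbr.
by clear -E1 h1; lra.
Qed.

(** On [pa], the crossing point with [uv] has [k > 0] and the one with [cd] has [k < 0], so the
    latter is nearer to [a] and left of [uv]. As a convex combination of [c] and [d], it would be on
    the right or on [uv] if both of them were. *)
Lemma traverses_face k p q b a u v c d :
  traverses p q b a u v -> traverses b a p q c d ->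
  0 < aff k p -> aff k a < 0 -> 0 < aff k u -> 0 < aff k v ->
  aff k c < 0 -> aff k d < 0 -> o u v c <= 0 -> o u v d <= 0 -> False.
Proof.
move=> /and5P[tp tq ta tb /and4P[apu apv qbv qbu]].
move=> /and5P[sb sa sq sp /and4P[qbc qbd apd apc]] kp ka ku kv kc kd uvc uvd.
have E1 : o u v a * aff k p - o u v p * aff k a = o a p v * aff k u - o a p u * aff k v
  by o_ring.
have E2 : o c d a * aff k p - o c d p * aff k a = o a p d * aff k c - o a p c * aff k d
  by o_ring.
have E3 : o c d a * o u v p - o c d p * o u v a = o a p d * o u v c - o a p c * o u v d
  by o_ring.
(* Up to nonzero factors, [h1] and [h2] evaluate [k] at the crossing points of [uv] and [cd] with
   [pa], and [h3] evaluates [o u v] at the second one. *)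
have h1 : 0 < o u v a * aff k p - o u v p * aff k a.
  by rewrite E1; clear -apv apu ku kv; nra.
have h2 : 0 < o c d a * aff k p - o c d p * aff k a.
  by rewrite E2; clear -apd apc kc kd; nra.
have h3 : 0 <= o c d a * o u v p - o c d p * o u v a.
  by rewrite E3; clear -apd apc uvc uvd; nra.
have h4 : o u v p * - aff k a * (- o c d a * aff k p)
    >= - (o u v a * aff k p) * (- o c d a * aff k p).
  apply: ler_wpM2r; last by lra.
  by apply: mulr_ge0; [rewrite oppr_ge0|exact: ltW].
have h5 : - (o u v a * aff k p) * (- o c d a * aff k p)
    > - (o u v a * aff k p) * (o c d p * - aff k a).
  rewrite ltr_nM2l; first by lra.
  by rewrite oppr_lt0; exact: mulr_gt0.
have h6 : 0 < - aff k a * aff k p by apply: mulr_gt0; rewrite ?oppr_gt0.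
have h7 := mulr_ge0 h3 (ltW h6).
by clear -h4 h5 h7; lra.
Qed.

(** * Condition C2 from two crossing edges in conflict *)

Lemma open_tri_sor a b c x :
  0 < o a b x -> 0 < o b c x -> 0 < o c a x -> open_tri a b c x.
Proof.
move=> abx bcx cax.
have D : o a b c = o b c x + o c a x + o a b x by o_ring.
have D0 : 0 < o a b c by rewrite D; lra.
have D1 : o a b c != 0 by exact: lt0r_neq0.
(* Barycentric coordinates as ratios of areas, in which the scale [e] cancels. *)
exists (o b c x / o a b c), (o c a x / o a b c), (o a b x / o a b c); split.
  by split; rewrite ?divr_gt0 // -!mulrDl -D divff.
have cl t y : t / o a b c * y * o a b c = t * y by rewrite mulrAC divfK.
by split; apply: (mulIf D1); rewrite !mulrDl !cl; o_ring.
Qed.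

Lemma wedge_sor a b c x :
  0 < o a b c -> 0 < o a x c -> 0 < o a b x -> wedge a b c x.
Proof.
move=> D0 axc abx; have D1 : o a b c != 0 by exact: lt0r_neq0.
exists (o a x c / o a b c), (o a b x / o a b c); rewrite !divr_gt0 //.
have cl t y : t / o a b c * y * o a b c = t * y by rewrite mulrAC divfK.
by split=> //; apply: (mulIf D1); rewrite !mulrDl !cl; o_ring.
Qed.

Lemma hull_edge_sor (X : seq pt) u v :
  e != 0 -> u \in X -> v \in X -> u != v -> (forall x, x \in X -> o u v x <= 0) ->
  hull_edge X u v.
Proof.
move=> e0 uX vX uv H; split=> //.
case: (ltP 0 e) => [ep|en]; [right | left] => x /H.
  by rewrite /sor pmulr_rle0.
by rewrite /sor nmulr_rle0 // lt_neqAle e0.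
Qed.

Lemma sor_neq0 (S : seq pt) x y z :
  e != 0 -> general_position S -> x \in S -> y \in S -> z \in S ->
  x != y -> y != z -> x != z -> o x y z != 0.
Proof. by move=> e0 gp xS yS zS xy yz xz; rewrite mulf_neq0 ?gp. Qed.

Lemma traverses_condC2 (X Y : seq pt) k p q b a u v c d :
  e != 0 -> general_position (X ++ Y) ->
  (forall x, x \in X -> 0 < aff k x) -> (forall y, y \in Y -> aff k y < 0) ->
  p \in X -> q \in X -> a \in Y -> b \in Y ->
  u \in X -> v \in X -> c \in Y -> d \in Y ->
  squad p q b a -> traverses p q b a u v -> traverses b a p q c d ->
  (forall x, x \in X -> o u v x <= 0) -> (forall y, y \in Y -> o c d y <= 0) ->
  o u v d < 0 -> condC2 X Y.
Proof.
move=> e0 gp kX kY pX qX aY bY uX vX cY dY sq tr sr hX hY uvd.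
have inX x : x \in X -> x \in X ++ Y by rewrite mem_cat => ->.
have inY y : y \in Y -> y \in X ++ Y by rewrite mem_cat orbC => ->.
have neXY x y : x \in X -> y \in Y -> x != y.
  by move=> /kX kx /kY ky; apply: contraTneq kx => ->; rewrite -leNgt ltW.
have neYX x y : x \in X -> y \in Y -> y != x by move=> xX yY; rewrite eq_sym neXY.
case/and5P: (tr) => [tp tq ta tb /and4P[apu apv qbv qbu]].
case/and5P: (sr) => [sb sa sq' sp /and4P[qbc qbd apd apc]].
case/and4P: (sq) => [c1 c2 c3 c4].
have uv : u != v by apply: contraTneq apv => <-; rewrite -leNgt.
have cd : c != d by apply: contraTneq apc => ->; rewrite -leNgt.
have uvc : 0 < o u v c.
  rewrite ltNge; apply/negP => uvc.
  by apply: (@traverses_face k p q b a u v c d) => //;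
    first [exact: kX | exact: kY | exact: ltW].
have E : o u v c * aff k d - o u v d * aff k c = o c d v * aff k u - o c d u * aff k v
  by o_ring.
have cdv' : o c d v = o c d u + o u v c - o u v d by o_ring.
have cdu : 0 < o c d u.
  (* If neither [u] nor [v] is left of [cd], [traverses_face] applies with the colours exchanged and
     [k] negated. If only [v] is, the segments [uv] and [cd] meet, and by [E] the meeting point
     would have [k] of both signs. *)
  rewrite ltNge; apply/negP => cdu; case: (lerP (o c d v) 0) => cdv.
    apply: (@traverses_face (- k.1.1, - k.1.2, - k.2) b a p q c d u v) => //;
      rewrite /aff /= !mulNr -!opprD ?oppr_gt0 ?oppr_lt0;
      first [exact: kX | exact: kY].
  have := kX _ uX; have := kX _ vX; have := kY _ cY; have := kY _ dY => kd kc kv ku.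
  by clear -E cdv cdu kd kc kv ku uvc uvd; nra.
have cdv : 0 < o c d v by rewrite cdv'; clear -cdu uvc uvd; lra.
(* The segment [dv] meets the line [pa] strictly to the right of [uv], so [a] is on the left of
   [dv]. *)
have dva : 0 < o d v a.
  have h1 : o d v a - o d v p = o a p v - o a p d by o_ring.
  have h2 : o d v a * o u v p - o d v p * o u v a = o a p v * o u v d by o_ring.
  have h3 : o a p v * o u v d < 0 by clear -apv uvd; nra.
  by clear -h1 h2 h3 apv apd ta tp; nra.
have vca0 : o v c a != 0.
  have ca : c != a.
    by apply: contraTneq apc => ->; rewrite (_ : o a p a = 0) ?ltxx //; o_ring.
  by apply: (sor_neq0 e0 gp); auto.
(* The sign decides whether [a] is in the wedge at [v] over [cd]; if so, C2 holds with edge [cd],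
   apex [v] and inner point [u]. *)
case: (ltP 0 (o v c a)) => vca.
  right; exists c, d, v, u; split; [split=> // | split].
  - exact: hull_edge_sor.
  - apply: open_tri_sor => //.
      by rewrite (_ : o d v u = - o u v d) ?oppr_gt0 //; o_ring.
    by have -> : o v c u = o u v c by o_ring.
  - move=> y yY [s [t [r [[s0 t0 r0 str] [y1 y2]]]]].
    have := hY _ yY; rewrite leNgt => /negP; apply.
    have -> : o c d y = r * o c d v.
      rewrite /sor /orient y1 y2; have -> : s = 1 - t - r by rewrite -str; ring.
      ring.
    exact: mulr_gt0.
  exists a; split=> //; apply: wedge_sor => //.
    by have -> : o v c d = o c d v by o_ring.
  by have -> : o v a d = o d v a by o_ring.
have {vca0} vca : o v c a < 0 by rewrite lt_neqAle vca0.
have vac : 0 < o v a c by rewrite (_ : o v a c = - o v c a) ?oppr_gt0 //; o_ring.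
(* The segment [cd] crosses [pa] at a point not to the right of [au]. If [c] were not left of [au],
   then [d] would be strictly right of it, and so would the crossing point. *)
have auc : 0 < o a u c.
  have h1 : o c d a * o a u p = o a p d * o a u c - o a p c * o a u d by o_ring.
  have h2 : o c d a - o c d u = o a u d - o a u c by o_ring.
  have h3 : o a u p = - o a p u by o_ring.
  have h4 : o c d a * o a u p <= 0 by rewrite h3; clear -sa apu; nra.
  rewrite ltNge; apply/negP => h5.
  have h6 : 0 < o a p c * - o a u d by apply: mulr_gt0 => //; clear -h2 h5 sa cdu; lra.
  by clear -h1 h4 h6 h5 apd; nra.
left; exists u, v, a, c; split; [split=> // | split].
- exact: hull_edge_sor.
- exact: open_tri_sor.
- move=> x xX [s [t [r [[s0 t0 r0 str] [x1 x2]]]]].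
  have := hX _ xX; rewrite leNgt => /negP; apply.
  have -> : o u v x = r * o u v a.
    rewrite /sor /orient x1 x2; have -> : s = 1 - t - r by rewrite -str; ring.
    ring.
  exact: mulr_gt0.
have auv : 0 < o a u v by have -> : o a u v = o u v a by o_ring.
(* The wedge at [a] contains [p] unless [p = u], and then [q] unless [q = v]. If [uv] is the side
   [pq] itself, convexity contradicts [vca]. *)
have [pu|pu] := eqVneq p u; last first.
  exists p; split=> //; apply: wedge_sor => //.
  have -> : o a u p = - o a p u by o_ring.
  by rewrite oppr_gt0 lt_neqAle apu andbT; apply: (sor_neq0 e0 gp); auto.
have [qv|qv] := eqVneq q v; last first.
  have uq : u != q.
    by apply: contraTneq qbu => ->; rewrite (_ : o q b q = 0) ?ltxx //; o_ring.
  exists q; split=> //; apply: wedge_sor; rewrite // -?pu //.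
  have uvq : o u v q < 0.
    rewrite lt_neqAle tq andbT; apply: (sor_neq0 e0 gp); auto.
    by rewrite eq_sym.
  have h1 : - o u v q * o q b a = o a q v * o q b u - o a q u * o q b v by o_ring.
  have h2 : o u v a - o u v q = o a q v - o a q u by o_ring.
  rewrite ltNge; apply/negP => h3.
  have h4 : 0 < - o u v q * o q b a by apply: mulr_gt0; rewrite ?oppr_gt0.
  by clear -h1 h2 h3 h4 ta uvq qbu qbv; nra.
have h : o p q b * o q c a = o p q c * o q b a - o a p q * o q b c by o_ring.
rewrite -pu -qv in uvc vca.
by exfalso; clear -h uvc vca c1 c2 c4 qbc; nra.
Qed.

End SignedOrientation.

(** * Existence of a hull edge that crosses the hole *)

Lemma seq_argmin (F : realFieldType) (T : eqType) (s : seq T) (P : pred T)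
    (f : T -> F) (x0 : T) :
  x0 \in s -> P x0 ->
  exists x, [/\ x \in s, P x & forall y, y \in s -> P y -> f x <= f y].
Proof.
elim: s x0 => [|z s IH] x0 //; rewrite inE => x0s Px0.
case: (boolP (has P s)) => [/hasP[y ys Py]|/hasPn nP].
  have [x [xs Px xmin]] := IH y ys Py.
  case: (boolP (P z && (f z < f x))) => [/andP[Pz zx]|nz].
    exists z; split; rewrite ?mem_head //.
    move=> w; rewrite inE => /predU1P[->//|ws Pw].
    exact: le_trans (ltW zx) (xmin w ws Pw).
  exists x; split; rewrite ?inE ?xs ?orbT //.
  move=> w; rewrite inE => /predU1P[->|]; last exact: xmin.
  by move=> Pz; move: nz; rewrite Pz /= -leNgt.
exists x0; split; rewrite ?inE //.
move=> w; rewrite inE => /predU1P[->|/nP/negP//] _.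
by case/predU1P: x0s => [->//|/nP/negP[]].
Qed.

Section TraversingEdges.
Variable F : realFieldType.
Local Notation pt := (F * F)%type.
Implicit Types (X Y : seq pt) (k : F * F * F) (p q r a b c d u v x y z : pt).

Lemma sorN (e : F) p q r : sor (- e) p q r = sor e q p r.
Proof. by rewrite /sor /orient; ring. Qed.

Lemma sor1 p q r : sor 1 p q r = orient p q r.
Proof. exact: mul1r. Qed.

Lemma squad_mirror (e : F) p q b a : squad e p q b a -> squad (- e) q p a b.
Proof.
have cyc x y z : sor e x y z = sor e y z x by rewrite /sor /orient; ring.
rewrite /squad !sorN => /and4P[h1 h2 h3 h4].
by rewrite -cyc h4 -cyc h3 -cyc h2 -cyc h1.
Qed.

(** With [squad_mirror], this transfers results about the side [pa] to the side [qb]. *)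
Lemma traverses_mirror (e : F) p q b a u v :
  traverses e p q b a u v -> traverses (- e) q p a b v u.
Proof.
case/and5P=> [h1 h2 h3 h4 /and4P[h5 h6 h7 h8]].
by rewrite /traverses !sorN h1 h2 h3 h4 h5 h6 h7 h8.
Qed.

Lemma aff_opp k x : aff (- k.1.1, - k.1.2, - k.2) x = - aff k x.
Proof. by rewrite /aff /=; ring. Qed.

(** Extremal argument: start from [pq] and take the traversing pair closest to [ab] in the sense of
    [f] below. A point of [X] to its left either allows a [traverses_step] at one end, which lowers
    [f], or lies in the empty quadrilateral by [traverses_gap]. *)
Lemma exists_traversing_edge X Y k p q b a :
  general_position (X ++ Y) ->
  (forall x, x \in X -> 0 < aff k x) -> (forall y, y \in Y -> aff k y < 0) ->
  p \in X -> q \in X -> a \in Y -> b \in Y -> squad 1 p q b a ->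
  (forall x, x \in X -> ~ in_quad_interior p q b a x) ->
  exists u v, [/\ u \in X, v \in X, traverses 1 p q b a u v &
                  forall x, x \in X -> sor 1 u v x <= 0].
Proof.
move=> gp kX kY pX qX aY bY sq empty.
have inX x : x \in X -> x \in X ++ Y by rewrite mem_cat => ->.
have inY y : y \in Y -> y \in X ++ Y by rewrite mem_cat orbC => ->.
have neYX x y : x \in X -> y \in Y -> y != x.
  by move=> /kX kx /kY ky; apply: contraTneq kx => <-; rewrite -leNgt ltW.
pose P (w : pt * pt) := traverses 1 p q b a w.1 w.2.
(* [f] decreases when the crossing points of the line [w] with the sides [pa], [qb]
   move towards [a], [b]. *)
pose f (w : pt * pt) :=
  sor 1 w.1 w.2 p / sor 1 w.1 w.2 a + sor 1 w.1 w.2 q / sor 1 w.1 w.2 b.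
have P0 : P (p, q).
  case/and4P: sq => [h1 h2 h3 h4].
  have o0 x y : sor 1 x y x = 0 by rewrite /sor /orient; ring.
  have o0' x y : sor 1 x y y = 0 by rewrite /sor /orient; ring.
  have cyc x y z : sor 1 x y z = sor 1 z x y by rewrite /sor /orient; ring.
  by rewrite /P /traverses /= !o0 !o0' lexx (cyc p q a) (cyc q b p) h1 h4.
have ltf (A B x y : F) : 0 < A -> 0 < B -> A * y < x * B -> y / B < x / A.
  by move=> A0 B0 h; rewrite ltr_pdivrMr // mulrAC ltr_pdivlMr // mulrC.
have lef (A B x y : F) : 0 < A -> 0 < B -> A * y <= x * B -> y / B <= x / A.
  by move=> A0 B0 h; rewrite ler_pdivrMr // mulrAC ler_pdivlMr // mulrC.
have [] := @seq_argmin F _ [seq (x, y) | x <- X, y <- X] P f (p, q) _ P0.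
  exact: allpairs_f.
move=> [u v] [/allpairsP[[u' v'] /= [uX vX [? ?]]] Puv min]; subst u' v'.
exists u, v; split=> // r rX; rewrite leNgt; apply/negP => uvr.
case/and5P: (Puv) => [tp tq ta tb _].
rewrite /= in tp tq ta tb.
case: (ltP (sor 1 a p r) 0) => [apr|apr].
  have [tr h1 h2] := traverses_step sq Puv (kY _ aY) (kY _ bY) (kX _ uX) (kX _ vX)
    (kX _ rX) uvr apr.
  have := min (r, v) (allpairs_f _ rX vX) tr; rewrite leNgt => /negP; apply.
  case/and5P: (tr) => [_ _ ra rb _].
  by rewrite /f /= ltr_leD ?ltf ?lef.
case: (ltP (sor 1 q b r) 0) => [qbr|qbr].
  have uvr' : 0 < sor (-1) v u r by rewrite sorN.
  have qbr' : sor (-1) b q r < 0 by rewrite sorN.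
  have [tr h1 h2] := traverses_step (squad_mirror sq) (traverses_mirror Puv)
     (kY _ bY) (kY _ aY) (kX _ vX) (kX _ uX) (kX _ rX) uvr' qbr'.
  have {}tr := traverses_mirror tr; rewrite opprK in tr.
  rewrite !sorN in h1 h2.
  have := min (u, r) (allpairs_f _ uX rX) tr; rewrite leNgt => /negP; apply.
  case/and5P: (tr) => [_ _ ra rb _].
  by rewrite /f /= ler_ltD ?ltf ?lef.
have [pqr bar] := traverses_gap sq Puv (kY _ aY) (kY _ bY) (kX _ qX) (kX _ rX) uvr apr qbr.
have ner x : sor 1 u v x <= 0 -> x != r.
  by move=> h; apply: contraTneq uvr => <-; rewrite -leNgt.
have ne_pq : p != q.
  apply: contraTneq pqr => ->; rewrite (_ : sor 1 q q r = 0) ?ltxx //.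
  by rewrite /sor /orient; ring.
(* General position makes the weak inequalities at the sides [qb] and [ap] strict. *)
apply: (empty r rX); rewrite /in_quad_interior -!sor1; split=> //.
  rewrite lt_neqAle qbr andbT eq_sym; apply: (sor_neq0 (oner_neq0 F) gp); auto.
  by rewrite eq_sym; auto.
rewrite lt_neqAle apr andbT eq_sym.
by apply: (sor_neq0 (oner_neq0 F) gp); auto.
Qed.

End TraversingEdges.

(** * A balanced convex hole implies C1 or C2 *)

Section HoleConditions.
Variable F : realFieldType.
Local Notation pt := (F * F)%type.
Implicit Types (X Y : seq pt) (k : F * F * F) (p q r a b c d u v x y z : pt).

Lemma in_hull_orient_le0 X u v x :
  (forall y, y \in X -> orient u v y <= 0) -> in_hull X x -> orient u v x <= 0.
Proof.
move=> H [w [w0 [w1 [x1 x2]]]].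
have -> : orient u v x = \sum_(i < size X) w i * orient u v (nth (0, 0) X i).
  (* Multiplying the constant term by the total weight, which is 1, makes the expression linear in
     the weights. *)
  have -> : orient u v x =
      (v.1 - u.1) * x.2 - (v.2 - u.2) * x.1
      + ((v.2 - u.2) * u.1 - (v.1 - u.1) * u.2) * \sum_(i < size X) w i.
    by rewrite w1 /orient; ring.
  rewrite x1 x2 !mulr_sumr -sumrB -big_split /=; apply: eq_bigr => i _.
  by rewrite /orient; ring.
by apply: sumr_le0 => i _; rewrite mulr_ge0_le0 ?H ?mem_nth.
Qed.

Lemma general_position_catC X Y : general_position (X ++ Y) -> general_position (Y ++ X).
Proof.
move=> gp p q r pS qS rS; apply: gp; rewrite mem_cat orbC -mem_cat //.
Qed.

Lemma separated_notin X Y k :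
  (forall x, x \in X -> 0 < aff k x) -> (forall y, y \in Y -> aff k y < 0) ->
  forall x, x \in X -> (x \in Y) = false.
Proof.
by move=> kX kY x /kX kx; apply/negP => /kY; rewrite ltNge (ltW kx).
Qed.

(** The diagonals meet, and [k] would be both positive and negative at their common point. *)
Lemma quad_not_alternating k p1 p2 p3 p4 :
  convex_quad p1 p2 p3 p4 -> 0 < aff k p1 -> aff k p2 < 0 -> 0 < aff k p3 ->
  aff k p4 < 0 -> False.
Proof.
move=> [h1 h2 h3 h4] k1 k2 k3 k4.
have E : orient p3 p4 p1 * aff k p2 + orient p1 p2 p3 * aff k p4 =
         orient p2 p3 p4 * aff k p1 + orient p4 p1 p2 * aff k p3.
  by rewrite /aff /orient; ring.
have h5 := mulr_gt0 h2 k1; have h6 := mulr_gt0 h4 k3.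
have h7 : orient p3 p4 p1 * aff k p2 < 0 by rewrite pmulr_rlt0.
have h8 : orient p1 p2 p3 * aff k p4 < 0 by rewrite pmulr_rlt0.
by clear -E h5 h6 h7 h8; lra.
Qed.

(** Of the six colour patterns, the two alternating ones are excluded; each of the others becomes
    [X X Y Y] by a cyclic shift. *)
Lemma balanced_hole_normal X Y k p1 p2 p3 p4 :
  (forall x, x \in X -> 0 < aff k x) -> (forall y, y \in Y -> aff k y < 0) ->
  balanced_convex_4hole X Y p1 p2 p3 p4 ->
  exists p q b a, [/\ [/\ p \in X, q \in X, b \in Y & a \in Y], squad 1 p q b a &
    forall x, x \in X ++ Y -> ~ in_quad_interior p q b a x].
Proof.
move=> kX kY [/and5P[m1 m2 m3 m4 _] cq cX cY emp].
have col x : x \in X ++ Y ->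
    (x \in X) /\ (x \in Y) = false \/ (x \in X) = false /\ (x \in Y).
  rewrite mem_cat; case xX: (x \in X) => /= xY; last by right.
  by left; rewrite (separated_notin kX kY).
have sqE p q b a : convex_quad p q b a -> squad 1 p q b a.
  by case=> *; rewrite /squad !sor1; apply/and4P.
case: (cq) => [h1 h2 h3 h4].
move: cX cY => /=.
case: (col _ m1) => -[a1 b1]; case: (col _ m2) => -[a2 b2];
case: (col _ m3) => -[a3 b3]; case: (col _ m4) => -[a4 b4];
rewrite ?a1 ?a2 ?a3 ?a4 ?b1 ?b2 ?b3 ?b4 //= => _ _.
- by exists p1, p2, p3, p4; split=> //; exact: sqE.
- by case: (@quad_not_alternating k p1 p2 p3 p4); auto.
- exists p4, p1, p2, p3; split=> //; first by apply: sqE.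
  by move=> x xS [*]; apply: (emp x xS).
- exists p2, p3, p4, p1; split=> //; first by apply: sqE.
  by move=> x xS [*]; apply: (emp x xS).
- by case: (@quad_not_alternating k p2 p3 p4 p1); auto; split.
- exists p3, p4, p1, p2; split=> //; first by apply: sqE.
  by move=> x xS [*]; apply: (emp x xS).
Qed.

Lemma traverses_condC2_side X Y k p q b a u v c d :
  general_position (X ++ Y) ->
  (forall x, x \in X -> 0 < aff k x) -> (forall y, y \in Y -> aff k y < 0) ->
  p \in X -> q \in X -> a \in Y -> b \in Y ->
  u \in X -> v \in X -> c \in Y -> d \in Y ->
  squad 1 p q b a -> traverses 1 p q b a u v -> traverses 1 b a p q c d ->
  (forall x, x \in X -> sor 1 u v x <= 0) -> (forall y, y \in Y -> sor 1 c d y <= 0) ->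
  sor 1 u v c < 0 \/ sor 1 u v d < 0 -> condC2 X Y.
Proof.
move=> gp kX kY pX qX aY bY uX vX cY dY sq tr sr hX hY [uvc|uvd]; last first.
  exact: (traverses_condC2 (oner_neq0 F) gp kX kY pX qX aY bY uX vX cY dY sq tr sr).
have e0 : (-1 : F) != 0 by rewrite oppr_eq0 oner_neq0.
apply: (traverses_condC2 e0 gp kX kY qX pX bY aY vX uX dY cY
  (squad_mirror sq) (traverses_mirror tr) (traverses_mirror sr)).
- by move=> x /hX; rewrite sorN.
- by move=> y /hY; rewrite sorN.
- by rewrite sorN.
Qed.

Lemma hole_conditions X Y k :
  general_position (X ++ Y) ->
  (forall x, x \in X -> 0 < aff k x) -> (forall y, y \in Y -> aff k y < 0) ->
  has_balanced_convex_4hole X Y -> condC1 X Y \/ condC2 X Y.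
Proof.
move=> gp kX kY [p1 [p2 [p3 [p4 /(balanced_hole_normal kX kY)]]]].
move=> [p [q [b [a [[pX qX bY aY] sq emp]]]]].
have gp' := general_position_catC gp.
have kX' x : x \in X -> aff (- k.1.1, - k.1.2, - k.2) x < 0.
  by move=> xX; rewrite aff_opp oppr_lt0 kX.
have kY' y : y \in Y -> 0 < aff (- k.1.1, - k.1.2, - k.2) y.
  by move=> yY; rewrite aff_opp oppr_gt0 kY.
have sq' : squad 1 b a p q.
  by case/and4P: sq => *; apply/and4P.
have [u [v [uX vX tr hX]]] : exists u v, [/\ u \in X, v \in X,
    traverses 1 p q b a u v & forall x, x \in X -> sor 1 u v x <= 0].
  apply: (exists_traversing_edge gp kX kY) => // x xX.
  by apply: emp; rewrite mem_cat xX.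
have [c [d [cY dY sr hY]]] : exists c d, [/\ c \in Y, d \in Y,
    traverses 1 b a p q c d & forall y, y \in Y -> sor 1 c d y <= 0].
  apply: (exists_traversing_edge gp' kY' kX') => // y yY [] *.
  by apply: (emp y); rewrite ?mem_cat ?yY ?orbT.
have C2 : sor 1 u v c < 0 \/ sor 1 u v d < 0 -> condC2 X Y.
  exact: (traverses_condC2_side gp kX kY pX qX aY bY uX vX cY dY sq tr sr).
(* The same with colours exchanged and the separating line negated. *)
have C2' : sor 1 c d u < 0 \/ sor 1 c d v < 0 -> condC2 X Y.
  move=> h.
  have [] := traverses_condC2_side gp' kY' kX' bY aY qX pX cY dY uX vX sq' sr tr hY hX h.
    by right.
  by left.
have e1 := oner_neq0 F.
have inX x : x \in X -> x \in X ++ Y by rewrite mem_cat => ->.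
have inY y : y \in Y -> y \in X ++ Y by rewrite mem_cat orbC => ->.
have neXY x y : x \in X -> y \in Y -> x != y.
  by move=> xX yY; apply: contraTneq yY => <-; rewrite (separated_notin kX kY).
have neYX x y : x \in X -> y \in Y -> y != x by move=> xX yY; rewrite eq_sym neXY.
case/and5P: (tr) => [tp tq ta tb /and4P[apu apv qbv qbu]].
case/and5P: (sr) => [sb sa sq'' sp /and4P[qbc qbd apd apc]].
have uv : u != v by apply: contraTneq apv => <-; rewrite -leNgt.
have cd : c != d by apply: contraTneq apc => ->; rewrite -leNgt.
case: (ltP (sor 1 u v c) 0) => [h|uvc]; first by right; auto.
case: (ltP (sor 1 u v d) 0) => [h|uvd]; first by right; auto.
case: (ltP (sor 1 c d u) 0) => [h|cdu]; first by right; auto.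
case: (ltP (sor 1 c d v) 0) => [h|cdv]; first by right; auto.
have {}uvc : 0 < sor 1 u v c.
  by rewrite lt_neqAle uvc andbT eq_sym; apply: (sor_neq0 e1 gp); auto.
have {}uvd : 0 < sor 1 u v d.
  by rewrite lt_neqAle uvd andbT eq_sym; apply: (sor_neq0 e1 gp); auto.
have {}cdu : 0 < sor 1 c d u.
  by rewrite lt_neqAle cdu andbT eq_sym; apply: (sor_neq0 e1 gp); auto.
have {}cdv : 0 < sor 1 c d v.
  by rewrite lt_neqAle cdv andbT eq_sym; apply: (sor_neq0 e1 gp); auto.
(* No conflict remains, so [u v c d] is convex. Its interior is left of both edges, while each hull
   is on the right of its own edge or on it. *)
left; exists u, v, c, d; split.
- exact: (hull_edge_sor e1).
- exact: (hull_edge_sor e1).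
exists u, v, c, d; split=> //; last first.
  move=> x [uvx _ cdx _]; split=> hx.
    have : orient u v x <= 0 by apply: (in_hull_orient_le0 _ hx) => y /hX; rewrite sor1.
    by rewrite leNgt uvx.
  have : orient c d x <= 0 by apply: (in_hull_orient_le0 _ hx) => y /hY; rewrite sor1.
  by rewrite leNgt cdx.
have nX := separated_notin kX kY.
have nY y : y \in Y -> (y \in X) = false by apply: (separated_notin kY' kX').
split.
- by apply/and5P; split; auto.
- split; rewrite -sor1 //.
    by have -> : sor 1 v c d = sor 1 c d v by rewrite /sor /orient; ring.
  by have -> : sor 1 d u v = sor 1 u v d by rewrite /sor /orient; ring.
- by rewrite /= uX vX !nY.
- by rewrite /= cY dY !nX.
- move=> x; rewrite mem_cat => /orP[/hX|/hY]; rewrite sor1 leNgt => /negP h [uvx _ cdx _];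
  exact: h.
Qed.

End HoleConditions.

(** * Construction of a hole from C2 *)

Section HoleFromC2.
Variable F : realFieldType.
Local Notation pt := (F * F)%type.
Implicit Types (X Y : seq pt) (k : F * F * F) (p q r a b c d u v x y z : pt).

Ltac o_ring := rewrite /aff /sor /orient; ring.

(** Boolean form of the open triangle when [u v b] is positively oriented for [e], as needed for
    selecting a minimum. *)
Definition in_tri (e : F) u v b z : bool :=
  [&& 0 < sor e u v z, 0 < sor e v b z & 0 < sor e b u z].

(** Among the candidates, [r] minimizes the area of [z r v], so no point of [X] is inside [b z r v].
    A point of [Y] inside would be [z] if left of [uv], and otherwise would lie in the triangle
    [u v r], where [k > 0]. *)
Lemma single_tri_side_hole (e : F) X Y k u v b z r0 :
  (forall x, x \in X -> 0 < aff k x) -> (forall y, y \in Y -> aff k y < 0) ->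
  u \in X -> v \in X -> (forall x, x \in X -> sor e u v x <= 0) ->
  in_tri e u v b z -> (forall y, y \in Y -> in_tri e u v b y -> y = z) ->
  r0 \in X -> 0 < sor e b z r0 -> 0 < sor e v b r0 ->
  exists r, [/\ r \in X, squad e b z r v &
    forall y, y \in X ++ Y ->
      ~ [/\ 0 < sor e b z y, 0 < sor e z r y, 0 < sor e r v y & 0 < sor e v b y]].
Proof.
move=> kX kY uX vX hX /and3P[uvz vbz buz] uniq r0X bzr0 vbr0.
set o := sor e in hX uvz vbz buz uniq bzr0 vbr0 *.
have uvb : 0 < o u v b.
  have -> : o u v b = o u v z + o v b z + o b u z by rewrite /o; o_ring.
  by rewrite !addr_gt0.
have bzv : 0 < o b z v by have -> : o b z v = o v b z by rewrite /o; o_ring.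
have [r [rX /andP[bzr vbr] rmin]] := @seq_argmin F _ X
   (fun r => (0 < o b z r) && (0 < o v b r)) (fun r => o z r v) r0 r0X
   (introT andP (conj bzr0 vbr0)).
have uvr := hX _ rX.
have zvr : o z v r < 0.
  have E : o u v r * o b z v = o u v b * o z v r + o u v z * o v b r
    by rewrite /o; o_ring.
  have h1 := mulr_gt0 uvz vbr.
  have h2 : o u v r * o b z v <= 0 by rewrite pmulr_lle0.
  have : o u v b * o z v r < 0 by clear -E h1 h2; lra.
  by rewrite pmulr_rlt0.
have zrv : 0 < o z r v by rewrite (_ : o z r v = - o z v r) ?oppr_gt0 // /o; o_ring.
exists r; split=> //.
  by apply/and4P; split=> //; rewrite -/o (_ : o r v b = o v b r) // /o; o_ring.
move=> y; rewrite mem_cat => /orP[yX|yY] [bzy zry rvy vby].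
  have := rmin y yX; rewrite bzy vby => /(_ isT).
  have -> : o z r v = o z r y + o r v y + o z y v by rewrite /o; o_ring.
  by clear -zry rvy; lra.
case: (ltP 0 (o u v y)) => [uvy|uvy].
  have buy : 0 < o b u y.
    have E : o b u y * o b z v = o b u z * o v b y + o b z y * o u v b
      by rewrite /o; o_ring.
    rewrite -(pmulr_lgt0 _ bzv) E; apply: addr_gt0; exact: mulr_gt0.
  have yz : y = z by apply: uniq => //; rewrite /in_tri -/o uvy vby buy.
  by move: bzy; rewrite yz (_ : o b z z = 0) ?ltxx // /o; o_ring.
have rzu : 0 < o r z u.
  have E : o r z u * o b z v = o b u z * - o z v r + o u v z * o b z r
    by rewrite /o; o_ring.
  rewrite -(pmulr_lgt0 _ bzv) E; apply: addr_gt0; apply: mulr_gt0 => //.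
  by rewrite oppr_gt0.
have ury : 0 < o u r y.
  have E : o u r y * o z r v = o z r y * - o u v r + o r v y * o r z u
    by rewrite /o; o_ring.
  rewrite -(pmulr_lgt0 _ zrv) E; apply: ltr_wpDl; last exact: mulr_gt0.
  by rewrite mulr_ge0 ?oppr_ge0 // ltW.
have E : aff k y * - o u v r = aff k u * o r v y + aff k r * - o u v y + aff k v * o u r y
  by rewrite /o; o_ring.
have h1 := mulr_gt0 (kX _ uX) rvy; have h2 := mulr_gt0 (kX _ vX) ury.
have h3 : 0 <= aff k r * - o u v y by rewrite mulr_ge0 ?oppr_ge0 // ltW ?kX.
have h4 : aff k y * - o u v r <= 0 by rewrite mulr_le0_ge0 ?oppr_ge0 // ltW ?kY.
by clear -E h1 h2 h3 h4; lra.
Qed.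

(** The side of the line [bz] on which [r] lies decides whether [v] or, by reflection, [u] is the
    fourth vertex. *)
Lemma single_tri_hole X Y k u v b z r :
  general_position (X ++ Y) ->
  (forall x, x \in X -> 0 < aff k x) -> (forall y, y \in Y -> aff k y < 0) ->
  u \in X -> v \in X -> (forall x, x \in X -> sor 1 u v x <= 0) ->
  b \in Y -> z \in Y -> in_tri 1 u v b z ->
  (forall y, y \in Y -> in_tri 1 u v b y -> y = z) ->
  r \in X -> 0 < sor 1 b u r -> 0 < sor 1 v b r ->
  has_balanced_convex_4hole X Y.
Proof.
move=> gp kX kY uX vX hX bY zY tz uniq rX bur vbr.
have inX x : x \in X -> x \in X ++ Y by rewrite mem_cat => ->.
have inY y : y \in Y -> y \in X ++ Y by rewrite mem_cat orbC => ->.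
have nX := separated_notin kX kY.
have nY y : y \in Y -> (y \in X) = false.
  by move=> yY; apply/negP => /nX; rewrite yY.
have neYX x y : x \in X -> y \in Y -> y != x.
  by move=> xX yY; apply: contraTneq yY => ->; rewrite nX.
case/and3P: (tz) => [uvz vbz buz].
have bz : b != z.
  by apply: contraTneq vbz => ->; rewrite (_ : sor 1 v z z = 0) ?ltxx //; o_ring.
have bzr0 : sor 1 b z r != 0 by apply: (sor_neq0 (oner_neq0 F) gp); auto.
case: (ltP 0 (sor 1 b z r)) => bzr.
  have [w [wX /and4P[h1 h2 h3 h4] emp]] :=
    single_tri_side_hole kX kY uX vX hX tz uniq rX bzr vbr.
  exists b, z, w, v; split.
  - by apply/and5P; split; auto.
  - by split; rewrite -sor1.
  - by rewrite /= wX vX !nY.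
  - by rewrite /= bY zY !nX.
  - by move=> y yS []; rewrite -!sor1 => *; apply: (emp y yS).
have {bzr0} bzr : 0 < sor (-1) b z r.
  by rewrite (_ : sor (-1) b z r = - sor 1 b z r) ?oppr_gt0 ?lt_neqAle ?bzr0 //; o_ring.
have triN y : in_tri (-1) v u b y = in_tri 1 u v b y.
  by rewrite /in_tri !sorN; congr (_ && _); rewrite andbC.
have hX' x : x \in X -> sor (-1) v u x <= 0 by rewrite sorN; exact: hX.
have tz' : in_tri (-1) v u b z by rewrite triN.
have uniq' y : y \in Y -> in_tri (-1) v u b y -> y = z by rewrite triN; exact: uniq.
have ubr : 0 < sor (-1) u b r by rewrite sorN.
have [w [wX /and4P[h1 h2 h3 h4] emp]] :=
  single_tri_side_hole kX kY vX uX hX' tz' uniq' rX bzr ubr.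
have revE x y t : orient x y t = sor (-1) t y x by o_ring.
(* The reflected hole [b z w u] is clockwise, so its vertices are listed backwards. *)
exists u, w, z, b; split.
- by apply/and5P; split; auto.
- by split; rewrite revE.
- by rewrite /= wX uX !nY.
- by rewrite /= bY zY !nX.
- move=> y yS [g1 g2 g3 g4]; apply: (emp y yS).
  by split; rewrite sorN sor1.
Qed.

Lemma condC2_half_hole X Y k :
  general_position (X ++ Y) ->
  (forall x, x \in X -> 0 < aff k x) -> (forall y, y \in Y -> aff k y < 0) ->
  condC2_half X Y -> has_balanced_convex_4hole X Y.
Proof.
move=> gp kX kY.
have inX x : x \in X -> x \in X ++ Y by rewrite mem_cat => ->.
have inY y : y \in Y -> y \in X ++ Y by rewrite mem_cat orbC => ->.
have nX := separated_notin kX kY.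
have nY y : y \in Y -> (y \in X) = false.
  by move=> yY; apply/negP => /nX; rewrite yY.
have neXY x y : x \in X -> y \in Y -> x != y.
  by move=> xX yY; apply: contraTneq yY => <-; rewrite nX.
suff H : forall u v b z r, u \in X -> v \in X -> u != v ->
    (forall x, x \in X -> sor 1 u v x <= 0) ->
    b \in Y -> z \in Y -> open_tri u v b z -> ~ open_tri u v b r ->
    r \in X -> wedge b u v r -> has_balanced_convex_4hole X Y.
  move=> [u [v [b [z [[[uX vX uv hs] bY zY tz] [nt [r [rX wr]]]]]]]].
  have triC x : open_tri u v b x <-> open_tri v u b x.
    split=> -[s [t [w [[s0 t0 w0 h] [h1 h2]]]]]; exists t, s, w; rewrite h1 h2 -h;
    do !split=> //; ring.
  case: hs => hs.
    apply: (H v u b z r) => //; first by rewrite eq_sym.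
    - move=> x /hs h; rewrite (_ : sor 1 v u x = - orient u v x) ?oppr_le0 //; o_ring.
    - exact/triC.
    - by move=> /triC; exact: nt.
    - case: wr => s [t [s0 t0 h1 h2]]; exists t, s; rewrite h1 h2; split=> //; ring.
  by apply: (H u v b z r) => //; [move=> x /hs; rewrite sor1 | exact: nt].
move=> u v b z0 r uX vX uv hX bY z0Y [s [t [w [[s0 t0 w0 stw] [z1 z2]]]]] ntr rX wr.
have uvb0 : sor 1 u v b != 0 by apply: (sor_neq0 (oner_neq0 F) gp); auto.
case: wr => s' [t' [s'0 t'0 r1 r2]].
have uvrE : sor 1 u v r = (1 - s' - t') * sor 1 u v b.
  by rewrite /sor /orient r1 r2; ring.
have burE : sor 1 b u r = t' * sor 1 u v b by rewrite /sor /orient r1 r2; ring.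
have vbrE : sor 1 v b r = s' * sor 1 u v b by rewrite /sor /orient r1 r2; ring.
have o0 x y : sor 1 x y y = 0 by o_ring.
have o0' x y : sor 1 y x y = 0 by o_ring.
have ur : u != r.
  apply: contraTneq (mulf_neq0 (lt0r_neq0 t'0) uvb0) => ur.
  by rewrite -burE -ur o0 eqxx.
have vr : v != r.
  apply: contraTneq (mulf_neq0 (lt0r_neq0 s'0) uvb0) => vr.
  by rewrite -vbrE -vr o0' eqxx.
have uvr : sor 1 u v r < 0.
  by rewrite lt_neqAle hX // andbT; apply: (sor_neq0 (oner_neq0 F) gp); auto.
(* Were [b] on the same side of [uv] as [r], the wedge point [r] would lie in the triangle [uvb],
   which has no such point. *)
have uvb : 0 < sor 1 u v b.
  rewrite ltNge; apply/negP => uvb.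
  have h : 0 < 1 - s' - t' by clear -uvrE uvr uvb; nra.
  apply: ntr; exists s', t', (1 - s' - t'); split; first by split=> //; ring.
  by rewrite r1 r2; split; ring.
have bur : 0 < sor 1 b u r by rewrite burE mulr_gt0.
have vbr : 0 < sor 1 v b r by rewrite vbrE mulr_gt0.
have ws : s = 1 - t - w by rewrite -stw; ring.
have tz0 : in_tri 1 u v b z0.
  apply/and3P; split.
  - have -> : sor 1 u v z0 = w * sor 1 u v b by rewrite /sor /orient z1 z2 ws; ring.
    exact: mulr_gt0.
  - have -> : sor 1 v b z0 = s * sor 1 u v b by rewrite /sor /orient z1 z2 ws; ring.
    exact: mulr_gt0.
  - have -> : sor 1 b u z0 = t * sor 1 u v b by rewrite /sor /orient z1 z2 ws; ring.
    exact: mulr_gt0.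
pose o := @sor F 1.
(* [f] orders the points of the triangle by direction from [u], starting at [v]. *)
pose f y := o u v y / o b u y.
have fle x y : in_tri 1 u v b x -> in_tri 1 u v b y -> f x <= f y -> 0 <= o u x y.
  move=> /and3P[x1 x2 x3] /and3P[y1 y2 y3].
  rewrite ler_pdivrMr // mulrAC ler_pdivlMr // => h.
  have E : o u x y * o u v b = o u v y * o b u x - o u v x * o b u y by rewrite /o; o_ring.
  by rewrite -(pmulr_lge0 _ uvb) E subr_ge0.
have [z' [z'Y tz' z'min]] := @seq_argmin F _ Y (in_tri 1 u v b) f z0 z0Y tz0.
case: (boolP (has (fun y => in_tri 1 u v b y && (y != z')) Y)); last first.
  move=> /hasPn nh; apply: (single_tri_hole gp kX kY uX vX hX bY z'Y tz' _ rX) => //.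
  by move=> y yY ty; have := nh y yY; rewrite ty /= negbK => /eqP.
case/hasP=> y1 y1Y ty1.
have [z [zY /andP[tz zz'] zmin]] := @seq_argmin F _ Y
  (fun y => in_tri 1 u v b y && (y != z')) f y1 y1Y ty1.
have uz'z : 0 < o u z' z.
  rewrite lt_neqAle fle ?z'min // andbT eq_sym.
  by apply: (sor_neq0 (oner_neq0 F) gp); auto; rewrite eq_sym.
have second y : y \in Y -> in_tri 1 u v b y -> y != z' -> 0 <= o u z y.
  by move=> yY ty yz'; apply: fle => //; apply: zmin => //; rewrite ty.
case/and3P: (tz) => uvz vbz buz; case/and3P: (tz') => uvz' vbz' buz'.
(* [vwiden] and [uwiden]: the angle at [v] or [u] towards a point [x] of the triangle is contained
   in the angle towards [b]. *)
have vwiden x y : 0 < o u v x -> 0 < o v b x -> 0 < o v x y -> 0 < o u v y -> 0 < o v b y.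
  move=> h1 h2 h3 h4.
  have E : o v b y * o u v x = o v b x * o u v y + o v x y * o u v b by rewrite /o; o_ring.
  rewrite -(pmulr_lgt0 _ h1) E; apply: addr_gt0; exact: mulr_gt0.
have uwiden x y : 0 < o u v x -> 0 < o b u x -> 0 < o x u y -> 0 < o u v y -> 0 < o b u y.
  move=> h1 h2 h3 h4.
  have E : o b u y * o u v x = o b u x * o u v y + o x u y * o u v b by rewrite /o; o_ring.
  rewrite -(pmulr_lgt0 _ h1) E; apply: addr_gt0; exact: mulr_gt0.
have vzz'0 : o v z z' != 0 by apply: (sor_neq0 (oner_neq0 F) gp); auto.
(* In the first case [z'] is inside [uvz], alone because all other points come no earlier than [z]
   around [u]. The wedge at [z] still contains [r], as [r] is beyond [uv]. *)
case: (ltP 0 (o v z z')) => [vzz'|vzz'].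
  apply: (@single_tri_hole X Y k u v z z' r) => //.
  - apply/and3P; split=> //; rewrite -/o (_ : o z u z' = o u z' z) // /o; o_ring.
  - move=> y yY /and3P[uvy vzy zuy]; apply/eqP; apply: contraTT (zuy) => yz'.
    have ty : in_tri 1 u v b y.
      by apply/and3P; split=> //; [exact: (vwiden z)|exact: (uwiden z)].
    rewrite -leNgt (_ : sor 1 z u y = - o u z y) ?oppr_le0 ?second //.
    by rewrite /o; o_ring.
  - have E : o z u r * o u v b = o u v z * o b u r - o b u z * o u v r by rewrite /o; o_ring.
    rewrite -(pmulr_lgt0 _ uvb) E subr_gt0; apply: lt_trans (mulr_gt0 uvz bur).
    by rewrite pmulr_rlt0.
  - have E : o v z r * o u v b = o u v z * o v b r - o v b z * o u v r by rewrite /o; o_ring.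
    rewrite -(pmulr_lgt0 _ uvb) E subr_gt0; apply: lt_trans (mulr_gt0 uvz vbr).
    by rewrite pmulr_rlt0.
have {vzz'0} vz'z : 0 < o v z' z.
  rewrite (_ : o v z' z = - o v z z'); last by rewrite /o; o_ring.
  by rewrite oppr_gt0 lt_neqAle vzz'0.
exists u, v, z', z; split.
- by apply/and5P; split; auto.
- split; rewrite -sor1 //.
    by rewrite (_ : sor 1 z' z u = o u z' z) // /o; o_ring.
  by rewrite (_ : sor 1 z u v = o u v z) // /o; o_ring.
- by rewrite /= uX vX !nY.
- by rewrite /= zY z'Y !nX.
(* Points of [X] are not left of [uv]; a point of [Y] inside would come before [z] around [u]
   without being [z']. *)
move=> y; rewrite mem_cat => /orP[yX|yY] [uvy vz'y z'zy zuy]; rewrite -!sor1 in uvy vz'y z'zy zuy.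
  by have := hX _ yX; rewrite leNgt uvy.
have ty : in_tri 1 u v b y.
  by apply/and3P; split=> //; [exact: (vwiden z')|exact: (uwiden z)].
have yz' : y != z' by apply: contraTneq vz'y => ->; rewrite o0 ltxx.
have := second y yY ty yz'; rewrite leNgt => /negP; apply.
by rewrite (_ : o u z y = - o z u y) ?oppr_lt0 // /o; o_ring.
Qed.

Lemma has_balanced_convex_4hole_sym X Y :
  has_balanced_convex_4hole X Y -> has_balanced_convex_4hole Y X.
Proof.
have catC x : (x \in X ++ Y) = (x \in Y ++ X) by rewrite !mem_cat orbC.
move=> [p1 [p2 [p3 [p4 [h1 h2 h3 h4 h5]]]]]; exists p1, p2, p3, p4; split=> //.
  by rewrite -(eq_all catC).
by move=> y; rewrite -catC; exact: h5.
Qed.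

End HoleFromC2.

Unset Implicit Arguments.

Theorem theorem4 (F : realFieldType) (Rs Bs : seq (F * F)%type) :
  general_position (Rs ++ Bs) ->
  (forall p, p \in Rs -> p \notin Bs) ->
  lin_separable Rs Bs ->
  (has_balanced_convex_4hole Rs Bs <-> condC1 Rs Bs \/ condC2 Rs Bs).
Proof.
move=> gp _ [al [be [ga [hR hB]]]].
pose k : F * F * F := (al, be, ga).
have kR x : x \in Rs -> 0 < aff k x by exact: hR.
have kB x : x \in Bs -> aff k x < 0 by exact: hB.
split; first exact: (hole_conditions gp kR kB).
case=> [[u [v [c [d [_ _ [p1 [p2 [p3 [p4 [h _ _]]]]]]]]]]|[]].
- by exists p1, p2, p3, p4.
- exact: (condC2_half_hole gp kR kB).
(* The half of C2 with the blue edge follows by exchanging the colours and negating the separating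
   line. *)
move=> h; apply: has_balanced_convex_4hole_sym.
apply: (@condC2_half_hole _ _ _ (- k.1.1, - k.1.2, - k.2) _ _ _ h).
- exact: general_position_catC.
- by move=> x xB; rewrite aff_opp oppr_gt0 kB.
- by move=> x xR; rewrite aff_opp oppr_lt0 kR.
Qed.
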